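(* Let $p$ be a prime and let $\mathcal{P}$ be a nontrivial monotone and non-evasive graph property on $2p$ vertices. Then all perfect matchings (on the $2p$ vertices) belong to $\mathcal{P}$.
   Context: Graphs are finite and simple. A graph property $\mathcal{P}$ on $n$ vertices is a collection of graphs with vertex set $\{1,\ldots,n\}$ (identified with their edge sets) that is closed under isomorphism of graphs. Its complexity $c(\mathcal{P})$ is the minimum $k$ such that some adaptive strategy of questions of the form ''is $\{i,j\}$ an edge of $G$?'' always determines, for every unknown graph $G$ on $\{1,\ldots,n\}$, whether $G\in\mathcal{P}$ using at most $k$ questions. $\mathcal{P}$ is evasive if $c(\mathcal{P})=\binom{n}{2}$, and non-evasive otherwise. $\mathcal{P}$ is monotone if it is closed under removal of edges. $\mathcal{P}$ is trivial if it is empty or consists of all graphs on $\{1,\ldots,n\}$, and nontrivial otherwise. *)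

(* Defs.v *)
From mathcomp Require Import all_boot all_fingroup.
From mathcomp Require Import boolp.

Set Implicit Arguments.
Unset Strict Implicit.
Unset Printing Implicit Defensive.

(* The vertex set {1, ..., n} is 'I_n. *)
Definition edge (n : nat) : Type := {e : {set 'I_n} | #|e| == 2}.

Definition graph (n : nat) : Type := {set edge n}.

Section GraphProperties.
Variable n : nat.
Implicit Types (G H : graph n) (P : {set graph n}).

Lemma perm_edge_proof (s : 'S_n) (e : edge n) : #|s @: val e| == 2.
Proof. by rewrite card_imset ?(valP e) //; exact: perm_inj. Qed.

Definition perm_edge (s : 'S_n) (e : edge n) : edge n :=
  Sub (s @: val e) (perm_edge_proof s e).

Definition isomorphic G H : Prop := exists s : 'S_n, H = perm_edge s @: G.

Definition graph_property P : Prop :=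
  forall G H, isomorphic G H -> G \in P -> H \in P.

Definition monotone P : Prop :=
  forall G H, H \subset G -> G \in P -> H \in P.

Definition trivial P : Prop := P = set0 \/ P = setT.

Definition perfect_matching G : Prop :=
  forall v : 'I_n, #|[set e in G | v \in val e]| = 1.

(* Adaptive strategies are binary decision trees; in [Query e t u], the
   strategy continues with [t] if [e] is an edge of the unknown graph, and
   with [u] otherwise. *)
Inductive strategy : Type :=
  | Answer of bool
  | Query of edge n & strategy & strategy.

Fixpoint answer (t : strategy) G : bool :=
  match t with
  | Answer b => b
  | Query e t1 t2 => if e \in G then answer t1 G else answer t2 G
  end.

Fixpoint questions (t : strategy) G : nat :=
  match t with
  | Answer _ => 0
  | Query e t1 t2 => (if e \in G then questions t1 G else questions t2 G).+1
  end.

Definition decidable_within P (k : nat) : Prop :=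
  exists t : strategy,
    forall G, answer t G = (G \in P) /\ questions t G <= k.

Lemma card_edge : #|{: edge n}| = 'C(n, 2).
Proof.
have := card_draws 'I_n 2; rewrite card_ord => <-.
by rewrite card_sig; apply: eq_card => e; rewrite !inE.
Qed.

Lemma decidable_within_binomial P : decidable_within P 'C(n, 2).
Proof.
suff step (s : seq (edge n)) (K : graph n) : exists t : strategy, forall G,
    (forall e, e \notin s -> (e \in G) = (e \in K)) ->
    answer t G = (G \in P) /\ questions t G <= size s.
  have [t tP] := step (enum {: edge n}) set0.
  exists t => G; rewrite -card_edge cardE; apply: tP => e.
  by rewrite mem_enum.
elim: s K => [|e s IHs] K.
  by exists (Answer (K \in P)) => G GK; split=> //=; congr (_ \in P);
    apply/setP => e; rewrite GK.
have [t1 t1P] := IHs (e |: K); have [t2 t2P] := IHs (K :\ e).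
exists (Query e t1 t2) => G GK /=.
case: ifPn => eG; [have [|-> ?] := t1P G | have [|-> ?] := t2P G] => //.
  move=> f fs; rewrite !inE; case: eqVneq => [->|fe] //=.
  by apply: GK; rewrite inE negb_or fe.
move=> f fs; rewrite !inE; case: eqVneq => [->|fe] /=; first exact: negbTE.
by apply: GK; rewrite inE negb_or fe.
Qed.

Lemma ex_decidable_within P : exists k, `[< decidable_within P k >].
Proof.
by exists 'C(n, 2); apply/asboolP; exact: decidable_within_binomial.
Qed.

Definition complexity P : nat := ex_minn (ex_decidable_within P).

Lemma complexity_decidable P : decidable_within P (complexity P).
Proof. by rewrite /complexity; case: ex_minnP => k /asboolP. Qed.

Lemma complexity_min P k : decidable_within P k -> complexity P <= k.
Proof.
by rewrite /complexity; case: ex_minnP => m _ mP Pk; apply/mP/asboolP.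
Qed.

Definition evasive P : Prop := complexity P = 'C(n, 2).

End GraphProperties.

(* Main.v *)
(** If a perfect matching M were missing from P, fix one and consider the poset
    Q of nonempty members of P. Non-evasiveness makes the order complex of Q
    acyclic over F_2: querying an edge splits P into a deletion and a link, and
    Mayer-Vietoris applies. The transpositions swapping the two ends of an edge
    of M are commuting involutions, so by Smith theory the order complex of the
    graphs in Q fixed by all of them is again acyclic; its reduced Euler
    characteristic is therefore 0. The group Z/p, shifting the p edges of M
    cyclically, acts on this complex; without a fixed vertex it would act freely
    on the nonempty simplices, and the reduced Euler characteristic would be
    -1 mod p. So some nonempty G in P is invariant under the shift and all the
    transpositions. With vertices written (i, b), i in Z/p and b a bit, such a G
    contains all edges {(x, 0), (x + d, 1)} for some d, hence a perfect
    matching, which is isomorphic to M. *)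

Require Import Defs.
From mathcomp Require Import all_boot all_fingroup all_algebra all_solvable.

Set Implicit Arguments.
Unset Strict Implicit.
Unset Printing Implicit Defensive.

Import GRing.Theory.
Local Open Scope ring_scope.

(** * Sums over F_2 *)

Lemma addrr_F2 (x : 'F_2) : x + x = 0.
Proof. by apply: addrr_pchar2; exact: pchar_Fp. Qed.

Lemma oppr_F2 (x : 'F_2) : - x = x.
Proof. by apply/eqP; rewrite -subr_eq0 -opprD addrr_F2 oppr0. Qed.

(** Off the diagonal, the terms at [(i, j)] and [(j, i)] cancel; [enum_rank] picks one of the
    two. *)
Lemma symmetric_sum_F2 (I : finType) (F : I -> I -> 'F_2) :
  (forall i, F i i = 0) -> (forall i j, F i j = F j i) ->
  \sum_i \sum_j F i j = 0.
Proof.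
move=> F0 FC; pose lt (i j : I) := (enum_rank i < enum_rank j)%N.
have split i : \sum_j F i j =
    \sum_(j | lt i j) F i j + \sum_(j | lt j i) F i j.
  rewrite (bigID (lt i)) /=; congr (_ + _).
  rewrite [LHS]big_mkcond [RHS]big_mkcond /=; apply: eq_bigr => j _.
  rewrite /lt; case: ltngtP => //= /ord_inj /enum_rank_inj ->.
  exact: F0.
rewrite (eq_bigr _ (fun i _ => split i)) big_split /=.
rewrite [X in _ + X](exchange_big_dep xpredT) //=.
under [X in _ + X]eq_bigr => j _ do under eq_bigr => i _ do rewrite FC.
exact: addrr_F2.
Qed.

(** * Simplicial chains over F_2, Mayer-Vietoris and cones *)

Section Chains.
Variable T : finType.
Implicit Types (A B : {set T}) (D : {set {set T}}).

Local Notation chains := {ffun {set T} -> 'F_2}.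
Implicit Types c z : chains.

Lemma addcc c : c + c = 0.
Proof. by apply/ffunP => A; rewrite !ffunE addrr_F2. Qed.

Lemma addcK c z : c + (c + z) = z.
Proof. by rewrite addrA addcc add0r. Qed.

(** Chains live on all subsets of [T], so that one boundary map serves every complex; a complex [D]
    enters only through supports. *)
Definition supported D c := [forall A, (c A != 0) ==> (A \in D)].

Lemma supportedP D c :
  reflect (forall A, A \notin D -> c A = 0) (supported D c).
Proof.
apply: (iffP forallP) => cD A; last first.
  by apply/implyP; apply: contraR => /cD ->.
by move=> AD; have := cD A; rewrite (negPf AD) implybF negbK => /eqP.
Qed.

Lemma supported0 D : supported D 0.
Proof. by apply/supportedP => A _; rewrite ffunE. Qed.

Lemma supportedD D c z : supported D c -> supported D z -> supported D (c + z).
Proof.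
move=> /supportedP cD /supportedP zD; apply/supportedP => A AD.
by rewrite ffunE cD // zD // addr0.
Qed.

Lemma supportedS D1 D2 c : D1 \subset D2 -> supported D1 c -> supported D2 c.
Proof.
move=> sD /supportedP cD; apply/supportedP => A AD; apply: cD.
by apply: contra AD; exact: (subsetP sD).
Qed.

Lemma supportedI D1 D2 c :
  supported (D1 :&: D2) c = supported D1 c && supported D2 c.
Proof.
apply/idP/andP => [cD|[/supportedP c1 /supportedP c2]].
  by split; apply: supportedS cD; rewrite ?subsetIl ?subsetIr.
by apply/supportedP => A; rewrite inE negb_and => /orP[/c1|/c2].
Qed.

Definition restrict D c : chains := [ffun A => if A \in D then c A else 0].

Lemma supported_restrict D c : supported D (restrict D c).
Proof. by apply/supportedP => A AD; rewrite ffunE (negPf AD). Qed.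

Lemma supported_restrictW D D' c : supported D c -> supported D (restrict D' c).
Proof.
by move=> /supportedP cD; apply/supportedP => A AD; rewrite ffunE cD // if_same.
Qed.

(* The boundary of the reduced (augmented) simplicial chain complex over F_2,
   all degrees being taken together. *)
Definition boundary c : chains :=
  [ffun A : {set T} => \sum_(x | x \notin A) c (x |: A)].

Lemma boundaryD c z : boundary (c + z) = boundary c + boundary z.
Proof.
apply/ffunP => A; rewrite !ffunE -big_split /=; apply: eq_bigr => x _.
by rewrite ffunE.
Qed.

Lemma boundary0 : boundary 0 = 0.
Proof.
by apply/ffunP => A; rewrite !ffunE big1 // => x _; rewrite ffunE.
Qed.

(** Each term [c (x |: (y |: A))] arises twice, once for each order in which [x] and [y] are
    added. *)
Lemma boundaryK c : boundary (boundary c) = 0.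
Proof.
apply/ffunP => A; rewrite !ffunE.
pose F x y := if [&& x \notin A, y \notin A & x != y]
  then c (x |: (y |: A)) else 0.
rewrite -[RHS](@symmetric_sum_F2 T F); first last.
- move=> x y; rewrite /F andbCA eq_sym; case: ifP => // _.
  by rewrite setUCA.
- by move=> x; rewrite /F eqxx !andbF.
rewrite big_mkcond /=; apply: eq_bigr => x _.
case: ifPn => xA; last first.
  by rewrite big1 // => y _; rewrite /F (negPf xA).
rewrite ffunE big_mkcond /=; apply: eq_bigr => y _.
rewrite /F xA !inE negb_or eq_sym andbC /=.
by case: ifP => // _; rewrite setUCA.
Qed.

Definition down_closed D := forall A B, B \subset A -> A \in D -> B \in D.

Lemma supported_boundary D c :
  down_closed D -> supported D c -> supported D (boundary c).
Proof.
move=> clD /supportedP cD; apply/supportedP => A AD.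
rewrite ffunE big1 // => x _; apply: cD; apply: contra AD.
exact/clD/subsetUr.
Qed.

(** Since the empty set counts as a simplex, this is vanishing of reduced homology: the void complex
    qualifies, [[set set0]] does not. *)
Definition acyclic D := forall z,
  supported D z -> boundary z = 0 -> exists2 b, supported D b & boundary b = z.

Lemma acyclic_set0 : acyclic set0.
Proof.
move=> z /supportedP z0 _; exists 0; first exact: supported0.
by apply/ffunP => A; rewrite boundary0 z0 ?inE // ffunE.
Qed.

(** Mayer-Vietoris by hand. Split a cycle as [a + b] along the two complexes; the common boundary of
    [a] and [b] is a cycle of the intersection, filled there by some [c]. Then [a + c] and [b + c]
    are cycles, and their fillings add up to a filling of [a + b]. *)
Lemma acyclicU D1 D2 : down_closed D1 -> down_closed D2 ->
  acyclic D1 -> acyclic D2 -> acyclic (D1 :&: D2) -> acyclic (D1 :|: D2).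
Proof.
move=> cl1 cl2 ac1 ac2 ac12 z zD bz.
pose a := restrict D1 z; pose b := z + a.
have aD : supported D1 a := supported_restrict D1 z.
have bD : supported D2 b.
  apply/supportedP => A AD; rewrite !ffunE; case: ifPn => A1.
    exact: addrr_F2.
  by rewrite (supportedP _ _ zD) ?addr0 // inE negb_or A1.
have bb : boundary b = boundary a by rewrite boundaryD bz add0r.
have [||c] := ac12 (boundary a).
- rewrite supportedI supported_boundary //= -bb.
  exact: supported_boundary.
- exact: boundaryK.
rewrite supportedI => /andP[c1 c2] bc.
have [||a' a'D ba'] := ac1 (a + c).
- exact: supportedD.
- by rewrite boundaryD bc addcc.
have [||b' b'D bb'] := ac2 (b + c).
- exact: supportedD.
- by rewrite boundaryD bc bb addcc.
exists (a' + b').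
  apply: supportedD.
  - by apply: supportedS a'D; rewrite subsetUl.
  - by apply: supportedS b'D; rewrite subsetUr.
by rewrite boundaryD ba' bb' addrACA addcc addr0 /b addrC -addrA addcc addr0.
Qed.

(** Joining every simplex of the cycle to the apex [x] is a contracting homotopy. *)
Lemma acyclic_cone D x :
  down_closed D -> (forall A, A \in D -> x |: A \in D) -> acyclic D.
Proof.
move=> clD coneD z zD bz.
pose b : chains := [ffun A : {set T} => if x \in A then z (A :\ x) else 0].
exists b.
  apply/supportedP => A AD; rewrite ffunE; case: ifP => // xA.
  apply: (supportedP _ _ zD); apply: contra AD => /coneD.
  by rewrite setD1K.
apply/ffunP => A; rewrite ffunE; case: (boolP (x \in A)) => xA; last first.
  rewrite (bigD1 x) //= ffunE setU11 setU1K // big1 ?addr0 // => y.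
  by move=> /andP[_ yx]; rewrite ffunE !inE eq_sym (negPf yx) (negPf xA).
(* At [A :\ x], the term of [boundary z] that adds [x] is [z A]; the other terms form the boundary
   of [b] at [A]. *)
have := congr1 (fun c : chains => c (A :\ x)) bz; rewrite !ffunE.
rewrite (bigD1 x) ?inE ?eqxx //= setD1K // => /eqP.
rewrite addr_eq0 oppr_F2 => /eqP ->; apply: eq_big => y.
  rewrite !inE; case: eqVneq => [->|] /=; first by rewrite xA.
  by rewrite andbT.
move=> yA; rewrite ffunE !inE xA orbT; congr (z _).
apply/setP => w; rewrite !inE; case: (eqVneq w y) => //= ->.
by rewrite andbT; apply: contraNneq yA => ->.
Qed.

End Chains.

(** * Smith theory for an involution *)

Section Smith.
Variables (T : finType) (D : {set {set T}}) (t : T -> T).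
Hypotheses (clD : down_closed D) (acD : acyclic D) (tK : involutive t)
  (tD : forall A, A \in D -> t @: A \in D)
  (tfix : forall A, A \in D -> t @: A = A -> forall x, x \in A -> t x = x).
Implicit Types A B : {set T}.

Local Notation chains := {ffun {set T} -> 'F_2}.
Implicit Types c z u f y w : chains.

(** Asking for pointwise fixed simplices yields a subcomplex; by [tfix] it contains every simplex of
    [D] that [t] preserves as a set. *)
Definition fixed_simplices := [set A in D | [forall x in A, t x == x]].

Let imsetK A : t @: (t @: A) = A.
Proof.
by rewrite -imset_comp -[RHS]imset_id; apply: eq_imset => x /=; rewrite tK.
Qed.

Let tDE A : (t @: A \in D) = (A \in D).
Proof. by apply/idP/idP => /tD //; rewrite imsetK. Qed.

Let fixedE A : A \in D -> (A \in fixed_simplices) = (t @: A == A).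
Proof.
move=> AD; rewrite inE AD; apply/forall_inP/eqP => [tA|tA x xA]; last first.
  exact/eqP/(tfix AD).
by rewrite -[RHS]imset_id; apply: eq_in_imset => x /tA /eqP.
Qed.

Let fixed_sub : fixed_simplices \subset D.
Proof. by apply/subsetP => A; rewrite inE => /andP[]. Qed.

Lemma closed_fixed_simplices : down_closed fixed_simplices.
Proof.
move=> A B BA; rewrite !inE => /andP[AD /forall_inP tA].
rewrite (clD BA) //=; apply/forall_inP => x xB.
by apply: tA; exact: (subsetP BA).
Qed.

(* The norm 1 + t of the group ring F_2[<t>]. *)
Let sigma c : chains := [ffun A : {set T} => c A + c (t @: A)].

Let sigmaD c z : sigma (c + z) = sigma c + sigma z.
Proof. by apply/ffunP => A; rewrite !ffunE addrACA. Qed.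

Let sigmaK c : sigma (sigma c) = 0.
Proof.
by apply/ffunP => A; rewrite !ffunE imsetK [X in _ + X]addrC addrr_F2.
Qed.

Let boundary_sigma c : boundary (sigma c) = sigma (boundary c).
Proof.
apply/ffunP => A; rewrite !ffunE.
under eq_bigr => x _ do rewrite ffunE.
rewrite big_split /=; congr (_ + _).
rewrite [RHS](reindex_inj (can_inj tK)); apply: eq_big => x.
  by rewrite (mem_imset _ _ (can_inj tK)).
by move=> _; rewrite imsetU1.
Qed.

Let supported_sigma c : supported D c -> supported D (sigma c).
Proof.
move=> /supportedP cD; apply/supportedP => A AD.
by rewrite ffunE !cD ?addr0 // tDE.
Qed.

Let sigma0_fixed c : supported fixed_simplices c -> sigma c = 0.
Proof.
move=> /supportedP cF; apply/ffunP => A; rewrite ffunE [RHS]ffunE.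
have [/eqP tA|tA] := boolP (t @: A == A); first by rewrite tA addrr_F2.
have nF B : t @: B != B -> c B = 0.
  move=> tB; apply: cF; have [BD|] := boolP (B \in D).
    by rewrite fixedE.
  by apply: contra => /(subsetP fixed_sub).
by rewrite !nF ?addr0 // imsetK eq_sym.
Qed.

(** From each free orbit of simplices, [u] keeps the one of smaller rank; [f] is the part of [c] on
    fixed simplices. The last two clauses preserve bounds on the degree. *)
Let invariant_split c : supported D c -> sigma c = 0 ->
  exists u f, [/\ supported D u, supported fixed_simplices f, c = sigma u + f,
    forall A, u A != 0 -> c A != 0 & forall A, f A != 0 -> c A != 0].
Proof.
move=> cD sc.
have cE A : c (t @: A) = c A.
  have := congr1 (fun z : chains => z A) sc; rewrite !ffunE => /eqP.
  by rewrite addr_eq0 oppr_F2 => /eqP.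
pose u : chains := [ffun A : {set T} =>
  if (enum_rank A < enum_rank (t @: A))%N then c A else 0].
exists u, (restrict fixed_simplices c); split.
- by apply/supportedP => A AD; rewrite ffunE (supportedP _ _ cD) ?if_same.
- exact: supported_restrict.
- apply/ffunP => A; rewrite !ffunE imsetK cE.
  have [AD|AD] := boolP (A \in D); last first.
    by rewrite (supportedP _ _ cD _ AD) !if_same !addr0.
  rewrite fixedE //; case: ltngtP => [lt|lt|/ord_inj/enum_rank_inj eq].
  + by case: eqP => [eq|]; rewrite ?addr0 //; rewrite eq ltnn in lt.
  + by case: eqP => [eq|]; rewrite ?addr0 ?add0r //; rewrite eq ltnn in lt.
  + by rewrite -eq eqxx !add0r.
- by move=> A; rewrite ffunE; case: ifP; rewrite ?eqxx.
- by move=> A; rewrite ffunE; case: ifP; rewrite ?eqxx.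
Qed.

Let degree_ge i : {set {set T}} := [set A : {set T} | (i <= #|A|)%N].

(** Simplices of [y] with at most [i] elements contribute only to sizes below [i], where [z]
    vanishes. *)
Let boundary_restrict i y z : supported (degree_ge i) z -> boundary y = z ->
  boundary (restrict (degree_ge i.+1) y) = z.
Proof.
move=> /supportedP zi yz; apply/ffunP => A.
have [Ai|Ai] := leqP i #|A|.
  rewrite -yz !ffunE; apply: eq_bigr => x xA.
  by rewrite ffunE inE cardsU1 xA add1n ltnS Ai.
rewrite zi ?inE -?ltnNge // ffunE big1 // => x xA.
by rewrite ffunE inE cardsU1 xA add1n ltnS leqNgt Ai.
Qed.

(* Downward induction on the degree in the long exact sequence attached to
   0 -> sigma C (+) C^t -> C -> sigma C -> 0: the sum on the left consists of
   the t-invariant chains, hence is the kernel of sigma. *)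
Let smith_step n i : (n + i = #|T|.+1)%N -> forall u f,
  supported D u -> supported (degree_ge i) u ->
  supported fixed_simplices f -> supported (degree_ge i) f ->
  boundary (sigma u) = 0 -> boundary f = 0 ->
  exists u' f', [/\ supported D u', supported fixed_simplices f',
    supported (degree_ge i.+1) u' /\ supported (degree_ge i.+1) f',
    boundary (sigma u') = sigma u & boundary f' = f].
Proof.
elim: n i => [|n IHn] i ni u f uD ui fD fi bu bf.
  (* In the base case [i] is [#|T|.+1], more than the size of any subset of [T]. *)
  have z0 c : supported (degree_ge i) c -> c = 0.
    move=> /supportedP ci; apply/ffunP => A; rewrite ffunE ci // inE -ltnNge.
    by rewrite -[i]add0n ni ltnS max_card.
  have s0 : sigma 0 = 0 by apply: sigma0_fixed; exact: supported0.
  by exists 0, 0; rewrite (z0 _ ui) (z0 _ fi) s0 boundary0 !supported0.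
have [||y yD yb] := acD (z := sigma u + f).
- apply: supportedD; [exact: supported_sigma | exact: supportedS fD].
- by rewrite boundaryD bu bf addr0.
have sui : supported (degree_ge i) (sigma u).
  apply/supportedP => A Ai; rewrite ffunE !(supportedP _ _ ui) ?addr0 //.
  by move: Ai; rewrite !inE card_imset //; exact: can_inj tK.
have yb' := boundary_restrict (supportedD sui fi) yb.
set y' := restrict _ y in yb'.
have y'D : supported D y' := supported_restrictW _ yD.
have y'i : supported (degree_ge i.+1) y' := supported_restrict _ _.
(* The chain [sigma y'] is a cycle, so the induction hypothesis gives [w] with
   [boundary (sigma w) = sigma y']. Adding [boundary w] to [y'] keeps its boundary and makes it
   invariant. *)
have [|||||||w [_ [wD _ [wi _] wb _]]] := IHn i.+1 _ y' 0;
  rewrite ?supported0 ?boundary0 ?addnS -?ni //.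
  by rewrite boundary_sigma yb' sigmaD sigmaK sigma0_fixed // addr0.
pose x := y' + boundary w.
have xD : supported D x by rewrite supportedD // supported_boundary.
have xi : supported (degree_ge i.+1) x.
  rewrite supportedD //; apply/supportedP => A; rewrite inE => Ai.
  rewrite ffunE big1 // => e eA; apply: (supportedP _ _ wi).
  by rewrite inE cardsU1 eA add1n.
have sx : sigma x = 0 by rewrite sigmaD -boundary_sigma wb addcc.
have [u' [f' [u'D f'D xE u'x f'x]]] := invariant_split xD sx.
have bx : boundary (sigma u') + boundary f' = sigma u + f.
  by rewrite -boundaryD -xE boundaryD boundaryK addr0.
(* At a fixed simplex every value of [sigma] is a doubled term, hence 0; elsewhere both sides vanish
   by their supports. *)
have bfE : boundary f' = f.
  have f'b := supported_boundary closed_fixed_simplices f'D.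
  apply/ffunP => A; have [AF|AF] := boolP (A \in fixed_simplices); last first.
    by rewrite (supportedP _ _ f'b) // (supportedP _ _ fD).
  have tA : t @: A = A.
    by apply/eqP; rewrite -fixedE //; exact: (subsetP fixed_sub).
  have := congr1 (fun z : chains => z A) bx.
  by rewrite /= boundary_sigma !ffunE tA !addrr_F2 !add0r.
have sub c : (forall A, c A != 0 -> x A != 0) -> supported (degree_ge i.+1) c.
  move=> cx; apply/supportedP => A Ai; apply/eqP.
  by apply: contraNT Ai => /cx; apply: contraR => /(supportedP _ _ xi) ->.
exists u', f'; split=> //; first by split; apply: sub.
by apply: (addIr f); rewrite -{1}bfE.
Qed.

Lemma acyclic_fixed_simplices : acyclic fixed_simplices.
Proof.
move=> z zF bz.
have ge0 c : supported (degree_ge 0) c.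
  by apply/supportedP => A; rewrite inE.
have [||||||_ [f' [_ f'F _ _ fb]]] := @smith_step _ 0 (addn0 _) 0 z => //.
- exact: supported0.
- rewrite boundary_sigma boundary0; apply/ffunP => A.
  by rewrite !ffunE addr0.
by exists f'.
Qed.

End Smith.

(** * Euler characteristic of an acyclic complex *)

Section Euler.
Variables (T : finType) (D : {set {set T}}).
Hypotheses (clD : down_closed D) (acD : acyclic D).

Local Notation chains := {ffun {set T} -> 'F_2}.

(** Rank-nullity as a count: the nonempty fibers of [f] on [V] are translates of its kernel. *)
Let card_fibers (V : {set chains}) (f : chains -> chains) :
  (forall c z, c \in V -> z \in V -> c + z \in V) ->
  {morph f : c z / c + z} ->
  #|V| = (#|f @: V| * #|[set c in V | f c == 0%R]|)%N.
Proof.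
move=> VD fD; rewrite -sum1_card.
rewrite (partition_big_imset f) /= -sum_nat_const; apply: eq_bigr => w.
case/imsetP => v vV ->; rewrite sum1_card.
rewrite -[RHS](card_imset _ (addrI v)); apply: eq_card => c.
rewrite [LHS]inE; apply/andP/imsetP => [[cV /eqP fc]|[z]].
  exists (v + c); last by rewrite addcK.
  by rewrite inE VD // fD fc addcc eqxx.
by rewrite inE => /andP[zV /eqP fz] ->; rewrite VD // fD fz addr0.
Qed.

Let part (b : bool) := [set A in D | odd #|A| == b].
Let C b : {set chains} := [set c | supported (part b) c].
Let Z b := [set c in C b | boundary c == 0].

(** The boundary reverses the parity of sizes, so a filling of a cycle of one parity may be
    restricted to the other. *)
Let boundary_image b : @boundary T @: C b = Z (~~ b).
Proof.
apply/setP => z; apply/imsetP/idP => [[c cC ->]|].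
  move: cC; rewrite !inE => cC; rewrite boundaryK eqxx andbT.
  apply/supportedP => A AD; rewrite ffunE big1 // => x xA.
  apply: (supportedP _ _ cC); apply: contra AD; rewrite !inE cardsU1 xA /=.
  case/andP=> AD /eqP <-; rewrite (clD (subsetUr _ _) AD) /=.
  by rewrite negbK.
rewrite !inE => /andP[zD /eqP bz].
have [||y yD yz] := acD (z := z) => //.
  by apply: supportedS zD; apply/subsetP => A; rewrite inE => /andP[].
exists (restrict (part b) y); first by rewrite inE supported_restrict.
apply/ffunP => A; rewrite ffunE.
have [oA|oA] := boolP (odd #|A| == ~~ b).
  rewrite -yz ffunE; apply: eq_bigr => x xA.
  rewrite ffunE inE cardsU1 xA /= (eqP oA) negbK eqxx andbT.
  by case: ifPn => // /(supportedP _ _ yD).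
rewrite (supportedP _ _ zD) ?inE ?(negPf oA) ?andbF // big1 // => x xA.
rewrite ffunE inE cardsU1 xA /=.
by rewrite (inv_eq negbK) (negPf oA) andbF.
Qed.

Let card_C b : #|C b| = (2 ^ #|part b|)%N.
Proof.
transitivity #|pffun_on (0 : 'F_2) (mem (part b)) predT|.
  apply: eq_card => c; rewrite inE; apply/idP/pffun_onP => [cC|[cC _]].
    split=> //; apply/subsetP => A; rewrite inE.
    by apply: contraR => /(supportedP _ _ cC) ->.
  apply/supportedP => A; apply: contraNeq => cA.
  by apply: (subsetP cC); rewrite inE.
by rewrite card_pffun_on card_Fp.
Qed.

(** The formula for [#|C b|] in [fib] is symmetric in [b], so there are as many odd chains as even
    ones; both numbers are powers of 2 whose exponents count simplices. *)
Lemma acyclic_euler :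
  #|[set A in D | odd #|A|]| = #|[set A in D | ~~ odd #|A|]|.
Proof.
have fib b : #|C b| = (#|Z (~~ b)| * #|Z b|)%N.
  rewrite -boundary_image; apply: card_fibers; last exact: boundaryD.
  by move=> c z; rewrite !inE; exact: supportedD.
have eqC : #|C true| = #|C false| by rewrite !fib mulnC.
have : #|part true| = #|part false|.
  by apply/eqP; rewrite -(eqn_exp2l _ _ (ltnSn 1)) -!card_C eqC.
by congr (_ = _); apply: eq_card => A; rewrite !inE; case: (odd _).
Qed.

End Euler.

Local Close Scope ring_scope.

(** * Order complexes, barycentric subdivisions and fixed points *)

Section OrderComplex.
Variable E : finType.
Implicit Types (A B x y : {set E}) (Q K : {set {set E}}) (C : {set {set E}}).

Definition nested x y := (x \subset y) || (y \subset x).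

Definition order_complex Q : {set {set {set E}}} :=
  [set C : {set {set E}} | (C \subset Q) &&
           [forall x in C, [forall y in C, nested x y]]].

Lemma nested_sym x y : nested x y = nested y x.
Proof. exact: orbC. Qed.

Lemma nested_card_eq x y : nested x y -> #|x| = #|y| -> x = y.
Proof.
case/orP=> sxy cxy; apply/eqP; first by rewrite eqEcard sxy cxy /=.
by rewrite eq_sym eqEcard sxy cxy /=.
Qed.

Lemma order_complexP Q C :
  reflect ({subset C <= Q} /\ {in C &, forall x y, nested x y})
          (C \in order_complex Q).
Proof.
rewrite inE; apply: (iffP andP) => [[/subsetP CQ /forall_inP cC]|[CQ cC]].
  by split=> // x y xC; exact: (forall_inP (cC x xC)).
split; first exact/subsetP.
by apply/forall_inP => x xC; apply/forall_inP => y; exact: cC.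
Qed.

Lemma order_complexU1 Q C A : A \in Q -> (forall x, x \in C -> nested A x) ->
  C \in order_complex Q -> A |: C \in order_complex Q.
Proof.
move=> AQ cA /order_complexP[CQ cC]; apply/order_complexP; split.
  by move=> x /setU1P[->|/CQ].
move=> x y /setU1P[->|xC] /setU1P[->|yC].
- by rewrite /nested subxx.
- exact: cA.
- by rewrite nested_sym cA.
- exact: cC.
Qed.

Lemma down_closed_order_complex Q : down_closed (order_complex Q).
Proof.
move=> C C' /subsetP sC /order_complexP[CQ cC]; apply/order_complexP.
by split=> [x /sC/CQ|x y /sC xC /sC]; last exact: cC.
Qed.

Lemma acyclic_order_complex_apex Q A : A \in Q ->
  (forall x, x \in Q -> nested A x) -> acyclic (order_complex Q).
Proof.
move=> AQ cA; apply: (@acyclic_cone _ _ A).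
  exact: down_closed_order_complex.
move=> C CQ; apply: order_complexU1 => // x xC.
by apply: cA; have /order_complexP[+ _] := CQ; exact.
Qed.

(* Conical contraction A <= A :|: [set e] >= [set e], done by removing one by
   one, the largest first, the members A of Q that do not contain e: the link
   of A at its removal is a cone with apex e |: A. *)
Lemma acyclic_order_complex_conical Q e : [set e] \in Q ->
  (forall A, A \in Q -> e |: A \in Q) -> acyclic (order_complex Q).
Proof.
have [n] := ubnP #|[set A in Q | e \notin A]|.
elim: n Q => // n IHn Q leQ eQ QU.
have [Q0|[A0 A0Q]] := set_0Vmem [set A in Q | e \notin A].
  apply: (acyclic_order_complex_apex eQ) => x xQ; apply/orP; left.
  rewrite sub1set; apply: contraTT isT => ex.
  by have := in_set0 x; rewrite -Q0 inE xQ ex.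
have [A AF Amax] := arg_maxnP (P := fun A => A \in [set A in Q | e \notin A])
  (fun A => #|A|) A0Q.
have {AF}/andP[AQ eA] : (A \in Q) && (e \notin A) by rewrite inE in AF.
have AeQ : e |: A \in Q :\ A.
  by rewrite !inE QU // andbT; apply: contraNneq eA => <-; rewrite setU11.
pose star := [set C in order_complex Q | A |: C \in order_complex Q].
have in_star C : (C \in star) =
    (C \in order_complex Q) && (A |: C \in order_complex Q) by rewrite in_set.
have cl_star : down_closed star.
  move=> C C' sC; rewrite !in_star => /andP[CQ ACQ].
  rewrite (down_closed_order_complex sC CQ).
  by rewrite (down_closed_order_complex _ ACQ) // setUS.
have -> : order_complex Q = star :|: order_complex (Q :\ A).
  apply/setP => C; rewrite in_setU; apply/idP/orP => [CQ|[]]; last first.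
  - case/order_complexP => CQ cC; apply/order_complexP; split=> // x /CQ.
    by rewrite inE => /andP[].
  - by rewrite in_star => /andP[].
  have [AC|AC] := boolP (A \in C).
    by left; rewrite in_star (setUidPr _) ?sub1set // CQ.
  right; case/order_complexP: CQ => CQ cC.
  apply/order_complexP; split=> // x xC.
  by rewrite !inE CQ // andbT; apply: contraNneq AC => <-.
apply: acyclicU => //.
- exact: down_closed_order_complex.
- apply: (@acyclic_cone _ _ A) => // C; rewrite !in_star => /andP[CQ ACQ].
  by rewrite ACQ setUA setUid.
- apply: IHn; last 1 first.
  + move=> B; rewrite !inE => /andP[BA BQ]; rewrite QU // andbT.
    by apply: contraNneq eA => <-; rewrite setU11.
  + rewrite -ltnS; apply: leq_trans leQ; rewrite ltnS.
    apply: proper_card; apply/properP; split.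
      by apply/subsetP => B; rewrite !inE => /andP[/andP[_ ->] ->].
    by exists A; rewrite !inE ?eqxx ?AQ.
  + rewrite !inE eQ andbT; apply: contraNneq eA => <-; exact: set11.
- apply: (@acyclic_cone _ _ (e |: A)).
    move=> C C' sC /setIP[C1 C2]; apply/setIP; split.
      exact: cl_star sC C1.
    exact: down_closed_order_complex sC C2.
  move=> C /setIP[]; rewrite in_star => /andP[CQ /order_complexP[_ cAC]] CA.
  (* A member [x] comparable with [A] lies in [A], or properly contains [A] and then contains [e] by
     maximality of [A]. *)
  have cA x : x \in C -> nested (e |: A) x.
    move=> xC; have /order_complexP[/(_ x xC)] := CA.
    rewrite !inE => /andP[xA xQ] _.
    have := cAC A x (setU11 _ _) (setU1r _ xC); rewrite /nested.
    case/orP => [Ax|xsA]; last by rewrite (subset_trans xsA) ?orbT // subsetUr.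
    apply/orP; left; rewrite subUset Ax sub1set andbT.
    apply: contraT => ex; have := Amax x; rewrite !inE xQ ex => /(_ isT).
    move=> cxA; case/negP: xA; rewrite eq_sym.
    by rewrite eqEcard Ax.
  apply/setIP; split; last exact: order_complexU1.
  have eAQ : e |: A \in Q by move: AeQ; rewrite inE => /andP[].
  have eCQ := order_complexU1 eAQ cA CQ.
  rewrite in_star eCQ; apply: order_complexU1 => // x /setU1P[->|xC].
    by rewrite /nested subsetUr.
  by apply: cAC; rewrite ?setU11 ?setU1r.
Qed.

(* The barycentric subdivision of K; unlike [order_complex (K :\ set0)], it
   distinguishes the void complex from [set set0]. *)
Definition subdivision K : {set {set {set E}}} :=
  [set C in order_complex (K :\ set0) | set0 \in K].

Lemma in_subdivision K C : (C \in subdivision K) =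
  (C \in order_complex (K :\ set0)) && (set0 \in K).
Proof. by rewrite in_set. Qed.

Lemma subdivisionE K : set0 \in K -> subdivision K = order_complex (K :\ set0).
Proof. by move=> K0; apply/setP => C; rewrite in_subdivision K0 andbT. Qed.

Lemma down_closed_subdivision K : down_closed (subdivision K).
Proof.
move=> C C' sC; rewrite !in_subdivision => /andP[CK ->]; rewrite andbT.
exact: down_closed_order_complex sC CK.
Qed.

Lemma acyclic_subdivision_void K : set0 \notin K -> acyclic (subdivision K).
Proof.
move=> K0; suff -> : subdivision K = set0 by exact: acyclic_set0.
by apply/setP => C; rewrite in_subdivision (negPf K0) andbF inE.
Qed.

Lemma acyclic_subdivision_powerset A : A != set0 ->
  acyclic (subdivision (powerset A)).
Proof.
move=> A0; rewrite subdivisionE ?inE ?sub0set //.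
apply: (@acyclic_order_complex_apex _ A); rewrite ?inE ?A0 ?subxx // => x.
by rewrite !inE => /andP[_ xA]; rewrite /nested xA orbT.
Qed.

Lemma acyclic_subdivision_cone K e : down_closed K ->
  (forall A, A \in K -> e |: A \in K) -> acyclic (subdivision K).
Proof.
move=> clK Ke; have [K0|] := boolP (set0 \in K); last first.
  exact: acyclic_subdivision_void.
have ne A : e |: A != set0 by apply/set0Pn; exists e; rewrite setU11.
rewrite subdivisionE //; apply: (@acyclic_order_complex_conical _ e).
  by rewrite !inE -[[set e]]setU0 ne Ke.
by move=> A; rewrite !inE ne => /andP[_ /Ke].
Qed.

(** Mayer-Vietoris for the star and the deletion of [e]: the star is a cone, and the two meet in the
    link. *)
Lemma acyclic_subdivision_link_deletion K e : down_closed K ->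
  acyclic (subdivision [set A in K | e \notin A]) ->
  acyclic (subdivision [set A in K | (e \notin A) && (e |: A \in K)]) ->
  acyclic (subdivision K).
Proof.
move=> clK acD acL.
pose del := [set A in K | e \notin A]; pose star := [set A in K | e |: A \in K].
have clS : down_closed star.
  move=> A B BA; rewrite !inE => /andP[AK AeK].
  by rewrite (clK _ _ BA AK) (clK _ _ _ AeK) // setUS.
have -> : subdivision K = subdivision star :|: subdivision del.
  apply/setP => C; rewrite in_setU; apply/idP/orP; last first.
    have sub K' : K' \subset K -> C \in subdivision K' -> C \in subdivision K.
      move=> /subsetP sK; rewrite !in_subdivision => /andP[+ K0].
      rewrite (sK _ K0) andbT => /order_complexP[CK cC].
      apply/order_complexP; split=> // x /CK.
      by rewrite !inE => /andP[-> /sK].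
    by case; apply: sub; apply/subsetP => A; rewrite inE => /andP[].
  rewrite in_subdivision => /andP[/order_complexP[CK cC] K0].
  have [/forall_inP Ce|] := boolP [forall A in C, e \notin A].
    right; rewrite in_subdivision [set0 \in del]inE K0 in_set0 andbT.
    apply/order_complexP; split=> // x xC; have := CK x xC.
    by rewrite !inE Ce // andbT.
  rewrite negb_forall_in => /exists_inP[A AC]; rewrite negbK => eA.
  (* Once a member [A] contains [e], the whole chain is in the star: a larger [x] contains [e], and
     for a smaller [x] the set [e |: x] is a subset of [A]. *)
  left; have : {subset C <= star}.
    move=> x xC; have := CK x xC; rewrite !inE => /andP[x0 xK]; rewrite xK /=.
    case/orP: (cC A x AC xC) => [Ax|xA].
      by rewrite (setUidPr _) // sub1set (subsetP Ax).
    have := CK A AC; rewrite !inE => /andP[_]; apply: clK.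
    by rewrite subUset sub1set eA.
  move=> Cs; rewrite in_subdivision (clS A) ?sub0set ?Cs // andbT.
  apply/order_complexP; split=> // x xC; have := CK x xC.
  by rewrite in_setD1 [in X in _ -> X]in_setD1 Cs // => /andP[->].
apply: acyclicU => //; try exact: down_closed_subdivision.
  apply: (@acyclic_subdivision_cone _ e) => // A.
  by rewrite !inE => /andP[_ AK]; rewrite AK setUA setUid.
suff -> : subdivision star :&: subdivision del =
  subdivision [set A in K | (e \notin A) && (e |: A \in K)] by [].
apply/setP => C; rewrite in_setI !in_subdivision ![set0 \in _]inE in_set0.
apply/andP/idP.
  case=> /andP[/order_complexP[C1 cC] /andP[-> ->]].
  case/andP=> /order_complexP[C2 _] _; rewrite !andbT.
  apply/order_complexP; split=> // x xC.
  have := C1 x xC; have := C2 x xC.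
  by rewrite !inE => /and3P[-> -> ->] /and3P[_ _ ->].
case/andP=> /order_complexP[CK cC] /and3P[-> _ ->]; rewrite andbT /=.
by split; rewrite ?andbT; apply/order_complexP; split=> // x /CK;
  rewrite !inE => /and4P[x0 xK xe xeK]; rewrite ?x0 ?xK ?xe ?xeK.
Qed.

(** Nested sets of equal size coincide, so a chain mapped to itself by [s] is fixed member by
    member. This is the condition [tfix] of Smith theory. *)
Lemma acyclic_order_complex_fixed Q (s : E -> E) : involutive s ->
  (forall A, A \in Q -> s @: A \in Q) -> acyclic (order_complex Q) ->
  acyclic (order_complex [set A in Q | s @: A == A]).
Proof.
move=> sK sQ acQ; pose t A := s @: A.
have card_t A : #|t A| = #|A| by apply: card_imset; exact: can_inj sK.
have tK : involutive t.
  move=> A; rewrite /t -imset_comp -[RHS]imset_id.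
  by apply: eq_imset => x /=; rewrite sK.
have -> : order_complex [set A in Q | s @: A == A] =
    fixed_simplices (order_complex Q) t.
  apply/setP => C; rewrite [RHS]inE; apply/order_complexP/andP.
    case=> CQ cC; split.
      by apply/order_complexP; split=> // x /CQ; rewrite inE => /andP[].
    by apply/forall_inP => x /CQ; rewrite inE => /andP[].
  case=> /order_complexP[CQ cC] /forall_inP tC; split=> // x xC.
  by rewrite inE CQ //; exact: tC.
apply: acyclic_fixed_simplices => //; first exact: down_closed_order_complex.
  move=> C /order_complexP[CQ cC]; apply/order_complexP; split.
    by move=> _ /imsetP[x xC ->]; apply/sQ/CQ.
  move=> _ _ /imsetP[x xC ->] /imsetP[y yC ->].
  by case/orP: (cC x y xC yC) => sxy; apply/orP; [left|right]; exact: imsetS.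
move=> C /order_complexP[CQ cC] tC x xC; apply: nested_card_eq => //.
by apply: cC => //; rewrite -tC imset_f.
Qed.

(** An invariant chain has invariant members. Were there no invariant member of [Q], the empty chain
    would be the only fixed one, so modulo [p] there would be one chain of even size and none of odd
    size, against [acyclic_euler]. *)
Lemma acyclic_pgroup_fixed p (G : {group {perm E}}) Q :
  prime p -> (p.-group G)%g -> acyclic (order_complex Q) ->
  (forall (s : {perm E}) A, s \in G -> A \in Q -> s @: A \in Q) ->
  exists2 A, A \in Q & forall s : {perm E}, s \in G -> s @: A = A.
Proof.
move=> p_pr pG acQ GQ.
pose F := [set A in Q | [forall s in G, s @: A == A]].
have [F0|[A]] := set_0Vmem F; last first.
  rewrite inE => /andP[AQ /forall_inP FA]; exists A => // s sG.
  exact/eqP/FA.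
pose to := ('P^*^*)%act : {action {perm E} &-> {set {set E}}}.
have toE C (s : {perm E}) : to C s = [set s @: x | x : {set E} in C].
  rewrite /to /= /setact; apply: eq_imset => x; rewrite /= /setact.
  by apply: eq_imset.
have OCG C s : s \in G -> C \in order_complex Q -> to C s \in order_complex Q.
  move=> sG /order_complexP[CQ cC]; rewrite toE; apply/order_complexP; split.
    by move=> _ /imsetP[x xC ->]; apply: GQ => //; exact: CQ.
  move=> _ _ /imsetP[x xC ->] /imsetP[y yC ->].
  by case/orP: (cC x y xC yC) => sxy; apply/orP; [left|right]; exact: imsetS.
have fix0 C : C \in order_complex Q -> C \in ('Fix_to(G))%g -> C = set0.
  move=> /order_complexP[CQ cC] /afixP CG.
  apply/eqP; apply: contraT => /set0Pn[x xC].
  have := in_set0 x; rewrite -F0 inE CQ //= => /negbT/negP[].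
  apply/forall_inP => s sG; apply/eqP; apply: nested_card_eq.
    by apply: cC => //; rewrite -(CG s sG) toE imset_f.
  by rewrite card_imset //; exact: perm_inj.
have card_fix b : #|[set C in order_complex Q | odd #|C| == b]| =
    #|[set C : {set {set E}} | (C == set0) && ~~ b]| %[mod p].
  rewrite [LHS](pgroup_fix_mod pG (to := to)); last first.
    apply/subsetP => s sG; apply/setIP; split; rewrite in_set //.
    apply/subsetP => C; rewrite inE => /andP[CQ oC].
    rewrite inE [_ \in _]inE; apply/andP; split; first exact: OCG.
    by rewrite toE card_imset //; apply: imset_inj; exact: perm_inj.
  congr (_ %% _); apply: eq_card => C; rewrite in_setI.
  rewrite [X in X && _]in_set [RHS]in_set.
  apply/andP/andP => [[/andP[CQ /eqP <-] CG]|[/eqP -> b0]].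
    by rewrite (fix0 C CQ CG) cards0 eqxx.
  split.
    rewrite cards0 eq_sym (negPf b0) andbT; apply/order_complexP.
    by split=> [x|x y]; rewrite inE.
  by apply/afixP => s sG; rewrite toE imset0.
have := acyclic_euler (@down_closed_order_complex Q) acQ.
have -> : [set C in order_complex Q | odd #|C|] =
    [set C in order_complex Q | odd #|C| == true].
  by apply/setP => C; rewrite [LHS]in_set [RHS]in_set eqb_id.
have -> : [set C in order_complex Q | ~~ odd #|C|] =
    [set C in order_complex Q | odd #|C| == false].
  by apply/setP => C; rewrite [LHS]in_set [RHS]in_set eqbF_neg.
move/(congr1 (modn^~ p)); rewrite !card_fix.
rewrite (_ : [set C | _ & ~~ true] = set0); last first.
  by apply/setP => C; rewrite !in_set andbF.
rewrite (_ : [set C | _ & ~~ false] = [set set0]); last first.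
  by apply/setP => C; rewrite !inE andbT.
by rewrite cards0 cards1 mod0n modn_small ?prime_gt1.
Qed.

End OrderComplex.

(** * Decision trees and acyclicity *)

Section GraphProperties.
Variable n : nat.
Implicit Types (G A F S : graph n) (P : {set graph n}) (e : edge n).

(** For disjoint [S] and [F], this is the link of [F] in [P], restricted to the vertex set [S]. *)
Definition contraction P S F : {set graph n} :=
  [set A in powerset S | A :|: F \in P].

Lemma down_closed_contraction P S F :
  monotone P -> down_closed (contraction P S F).
Proof.
move=> mP A B BA; rewrite !inE => /andP[AS AP].
by rewrite (subset_trans BA AS) (mP _ _ _ AP) // setSU.
Qed.

(* [S] holds the edges not yet queried, [F] those found to be present. *)
Lemma acyclic_contraction P (t : strategy n) S F : monotone P ->
  [disjoint S & F] ->
  (forall A, A \subset S -> answer t (A :|: F) = (A :|: F \in P) /\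
     questions t (A :|: F) < #|S|) ->
  acyclic (subdivision (contraction P S F)).
Proof.
move=> mP; elim: t S F => [b|e t1 IH1 t2 IH2] S F dSF tP.
  (* A leaf asks 0 questions, fewer than [#|S|], so [S] is nonempty: the answer [true] leaves a full
     simplex with a vertex, [false] the void complex. *)
  have S0 : S != set0.
    by have [_] := tP set0 (sub0set _); rewrite -card_gt0.
  case: b tP => tP.
    suff -> : contraction P S F = powerset S.
      exact: acyclic_subdivision_powerset.
    apply/setP => A; rewrite !inE; case: (boolP (A \subset S)) => //= AS.
    by have [/= <-] := tP A AS.
  apply: acyclic_subdivision_void; rewrite !inE sub0set /=.
  by have [/= <-] := tP set0 (sub0set _).
(* For [e] outside [S] the reply is already determined by [F], and one branch serves all [A]. *)
have [eS|eS] := boolP (e \in S); last first.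
  have eAF A : A \subset S -> (e \in A :|: F) = (e \in F).
    move=> AS; rewrite inE; have /negPf-> // : e \notin A.
    by apply: contra eS; exact: (subsetP AS).
  have [eF|eF] := boolP (e \in F).
    apply: IH1 => // A AS; have /= := tP A AS; rewrite eAF // eF.
    by case=> -> /ltnW.
  apply: IH2 => // A AS; have /= := tP A AS; rewrite eAF // (negPf eF).
  by case=> -> /ltnW.
have eF : e \notin F by rewrite (disjointFr dSF eS).
have cS : #|S| = #|S :\ e|.+1 by rewrite (cardsD1 e S) eS.
apply: (@acyclic_subdivision_link_deletion _ _ e).
- exact: down_closed_contraction.
- have -> : [set A in contraction P S F | e \notin A] =
      contraction P (S :\ e) F.
    by apply/setP => A; rewrite !inE subsetD1 andbAC.
  apply: IH2 => [|A].
    by apply: disjointWl dSF; exact: subsetDl.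
  rewrite subsetD1 => /andP[AS eA]; have /= := tP A AS.
  by rewrite inE (negPf eA) (negPf eF) cS ltnS.
- have -> : [set A in contraction P S F | (e \notin A) &&
      (e |: A \in contraction P S F)] = contraction P (S :\ e) (e |: F).
    apply/setP => A; rewrite !inE subsetD1 subUset sub1set eS /=.
    rewrite setUCA -setUA; case: (A \subset S) => //=.
    case: (e \notin A) => //=; rewrite ?andbF //=; apply: andb_idl => /mP.
    by apply; exact: subsetUr.
  apply: IH1 => [|A].
    rewrite -setI_eq0; apply/eqP/setP => x; rewrite !inE.
    case: eqVneq => //= _; have [xS|//] := boolP (x \in S).
    by rewrite (disjointFr dSF xS).
  rewrite subsetD1 => /andP[AS eA].
  have /= := tP (e |: A); rewrite subUset sub1set eS AS -setUA setU11 /=.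
  by rewrite -[A :|: (e |: F)]setUCA cS ltnS; apply.
Qed.

(** At the root of an optimal decision tree all edges are unqueried, and non-evasiveness means fewer
    questions than edges. *)
Lemma acyclic_nonevasive P : monotone P -> ~ evasive P -> set0 \in P ->
  acyclic (order_complex (P :\ set0)).
Proof.
move=> mP nevP P0; rewrite -subdivisionE //.
have [t tP] := complexity_decidable P.
have -> : P = contraction P setT set0.
  by apply/setP => A; rewrite !inE subsetT setU0.
apply: (@acyclic_contraction _ t) => //.
  by rewrite -setI_eq0 setI0.
move=> A _; rewrite setU0; have [-> qA] := tP A; split=> //.
apply: leq_ltn_trans qA _; rewrite cardsT card_edge ltn_neqAle.
rewrite complexity_min ?andbT; first exact/eqP.
exact: decidable_within_binomial.
Qed.

End GraphProperties.

(** * Graphs invariant under vertex permutations *)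

Local Open Scope group_scope.

Section Blocks.
Variable n : nat.
Implicit Types (G M : graph n) (P : {set graph n}) (e : edge n) (s : 'S_n).

Lemma val_perm_edge s e : val (perm_edge s e) = s @: val e.
Proof. by []. Qed.

Lemma perm_edge1 e : perm_edge 1 e = e.
Proof.
apply/val_inj; rewrite val_perm_edge -[RHS]imset_id.
by apply: eq_imset => v; rewrite perm1.
Qed.

Lemma perm_edgeM s t e : perm_edge (s * t) e = perm_edge t (perm_edge s e).
Proof.
apply/val_inj; rewrite !val_perm_edge -imset_comp.
by apply: eq_imset => v; rewrite permM.
Qed.

Lemma perm_edge_inj s : injective (perm_edge s).
Proof.
by apply: (can_inj (g := perm_edge s^-1)) => e;
  rewrite -perm_edgeM mulgV perm_edge1.
Qed.

Lemma perm_graphM s t G :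
  perm_edge (s * t) @: G = perm_edge t @: (perm_edge s @: G).
Proof. by rewrite -imset_comp; apply: eq_imset => e; exact: perm_edgeM. Qed.

Lemma graph_property_perm P s G :
  graph_property P -> G \in P -> perm_edge s @: G \in P.
Proof. by move=> gP; apply: gP; exists s. Qed.

(** The involutions are treated one at a time; commutation lets each act on the graphs fixed by
    those already treated. *)
Lemma acyclic_fixed_seq (Q : {set graph n}) (l : seq 'S_n) :
  {in l, forall t, t * t = 1} -> {in l &, forall t u, t * u = u * t} ->
  (forall t A, A \in Q -> perm_edge t @: A \in Q) ->
  acyclic (order_complex Q) ->
  acyclic (order_complex [set A in Q | all (fun t => perm_edge t @: A == A) l]).
Proof.
move=> lK lC QP acQ; elim: l lK lC => [|t l IHl] lK lC.
  suff -> : [set A in Q | all (fun t => perm_edge t @: A == A) [::]] = Q by [].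
  by apply/setP => A; rewrite inE andbT.
set Q1 := [set A in Q | all (fun t => perm_edge t @: A == A) l] in IHl.
have -> : [set A in Q | all (fun t => perm_edge t @: A == A) (t :: l)] =
    [set A in Q1 | perm_edge t @: A == A].
  by apply/setP => A; rewrite !inE /= -andbA [X in _ && X]andbC.
apply: acyclic_order_complex_fixed => [e|A|].
- by rewrite -perm_edgeM lK ?mem_head // perm_edge1.
- rewrite !inE => /andP[AQ /allP lA]; rewrite QP //=.
  apply/allP => u ul; rewrite -perm_graphM lC ?mem_head ?inE ?ul ?orbT //.
  by rewrite perm_graphM (eqP (lA u ul)).
- apply: IHl => [u ul|u v ul vl].
    by apply: lK; rewrite inE ul orbT.
  by apply: lC; rewrite inE ?ul ?vl orbT.
Qed.

(** The relation [c * t = u * c] makes [c] preserve the set of graphs fixed by all of [l], and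
    [c ^+ p = 1] makes the group it generates on edges a [p]-group. *)
Lemma exists_fixed_graph p P (l : seq 'S_n) (c : 'S_n) : prime p ->
  graph_property P -> monotone P -> ~ evasive P -> set0 \in P ->
  {in l, forall t, t * t = 1} -> {in l &, forall t u, t * u = u * t} ->
  {in l, forall t, exists2 u, u \in l & c * t = u * c} -> c ^+ p = 1 ->
  exists G, [/\ G \in P, G != set0, perm_edge c @: G = G
    & {in l, forall t, perm_edge t @: G = G}].
Proof.
move=> p_pr gP mP nevP P0 lK lC lc cp.
have QP t A : A \in P :\ set0 -> perm_edge t @: A \in P :\ set0.
  by rewrite !inE imset_eq0 => /andP[-> /(graph_property_perm t gP) ->].
have acQ := acyclic_fixed_seq lK lC QP (acyclic_nonevasive mP nevP P0).
pose pc : {perm edge n} := perm (@perm_edge_inj c).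
have pcX k e : (pc ^+ k) e = perm_edge (c ^+ k) e.
  elim: k e => [|k IHk] e; first by rewrite !expg0 perm1 perm_edge1.
  by rewrite !expgSr permM IHk perm_edgeM permE.
have pG : p.-group <[pc]>.
  apply: pnat_dvd (pnat_id p_pr); rewrite order_dvdn; apply/eqP/permP => e.
  by rewrite pcX cp perm1 perm_edge1.
have [|G GQ Gfix] := acyclic_pgroup_fixed p_pr pG acQ.
  move=> s A /cycleP[k ->]; elim: k A => [|k IHk] A AQ.
    suff -> : (pc ^+ 0) @: A = A by [].
    by rewrite -[RHS]imset_id; apply: eq_imset => e; rewrite expg0 perm1.
  have -> : (pc ^+ k.+1) @: A = (pc ^+ k) @: (perm_edge c @: A).
    rewrite -imset_comp; apply: eq_imset => e.
    by rewrite expgS permM permE.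
  apply: IHk; move: AQ; rewrite ![_ \in [set _ in _ | _]]in_set.
  case/andP=> AP /allP lA; rewrite QP //=; apply/allP => t tl.
  have [u ul ctu] := lc t tl.
  by rewrite -perm_graphM ctu perm_graphM (eqP (lA u ul)).
exists G; move: GQ; rewrite !inE => /andP[/andP[-> ->] /allP lG]; split=> //.
- rewrite -[RHS](Gfix pc (cycle_id _)).
  by apply: eq_imset => e; rewrite permE.
- by move=> t /lG /eqP.
Qed.
End Blocks.

(** * Coordinates adapted to a perfect matching, and the invariant graph *)

Lemma card_perfect_matching p (M : graph (2 * p)) :
  perfect_matching M -> #|M| = p.
Proof.
move=> Mpm; apply/eqP; rewrite -(eqn_pmul2l (ltn0Sn 1)) mulnC; apply/eqP.
(* Double counting of incidences: two per edge, one per vertex. *)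
transitivity (\sum_(e in M) \sum_(v in val e) 1).
  rewrite -sum_nat_const; apply: eq_bigr => e _.
  by rewrite sum1_card (eqP (valP e)).
rewrite (exchange_big_dep predT) //= -[RHS]card_ord -sum1_card.
apply: eq_bigr => v _; rewrite -[RHS](Mpm v) -sum1_card.
by apply: eq_bigl => e; rewrite inE.
Qed.

Lemma perfect_matching_coordinates p (M : graph (2 * p)) : 0 < p ->
  perfect_matching M ->
  exists2 f : 'I_p * bool -> 'I_(2 * p), bijective f &
    forall e, e \in M -> exists i, val e = [set f (i, false); f (i, true)].
Proof.
move=> p_gt0 Mpm; have cM := card_perfect_matching Mpm.
(* [e0] and [v0] will be default values for [nth]. *)
have /card_gt0P[e0 _] : 0 < #|M| by rewrite cM.
have /card_gt0P[v0 _] : 0 < #|val e0| by rewrite (eqP (valP e0)).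
pose m i := nth e0 (enum M) i.
have sM : size (enum M) = p by rewrite -cardE.
have mM (i : 'I_p) : m i \in M by rewrite -mem_enum mem_nth ?sM.
have s2 (e : edge (2 * p)) : size (enum (val e)) = 2.
  by rewrite -cardE (eqP (valP e)).
(* The bit [x.2], read as 0 or 1, indexes the ends of edge number [x.1]. *)
pose f (x : 'I_p * bool) := nth v0 (enum (val (m x.1))) x.2.
have fm i b : f (i, b) \in val (m i).
  by rewrite -mem_enum mem_nth // s2; case: b.
have f_inj : injective f.
  move=> [i b] [j b'] eqf; have /eqP/cards1P[e eP] := Mpm (f (i, b)).
  have me k d : f (k, d) = f (i, b) -> m k = e.
    by move=> fk; apply/set1P; rewrite -eP inE mM -fk fm.
  have ij : i = j.
    apply/val_inj/eqP; rewrite -(nth_uniq e0 _ _ (enum_uniq M)) ?sM ?ltn_ord //.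
    by rewrite -/(m i) -/(m j) (me i b) // (me j b').
  move: eqf; rewrite -ij /f /= => /eqP.
  by rewrite nth_uniq ?enum_uniq ?s2 //; move: (b) (b') => [] [].
exists f.
  by apply: inj_card_bij; rewrite // card_prod card_bool !card_ord mulnC.
move=> e eM; have eM' : index e (enum M) < p.
  by apply: leq_trans (eq_leq sM); rewrite index_mem mem_enum.
exists (Ordinal eM').
have me : m (Ordinal eM') = e by rewrite /m nth_index ?mem_enum.
have fe b : f (Ordinal eM', b) \in val e by rewrite -{2}me fm.
apply/esym/eqP; rewrite eqEcard subUset !sub1set !fe cards2 (inj_eq f_inj).
by rewrite (eqP (valP e)) xpair_eqE andbF.
Qed.

Lemma mulrn_Zp_card q (x : 'I_q.+2) : (x *+ q.+2 = 0)%R.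
Proof. by rewrite Zp_mulrn; apply/val_inj; rewrite /= modnMl. Qed.

Theorem proposition4p4 (p : nat) (P : {set graph (2 * p)}) :
  prime p ->
  graph_property P ->
  ~ trivial P ->
  monotone P ->
  ~ evasive P ->
  forall M : graph (2 * p), perfect_matching M -> M \in P.
Proof.
move=> p_pr gP ntP mP nevP M Mpm.
have P0 : set0 \in P.
  have [Pe|[A AP]] := set_0Vmem P; first by case: ntP; left.
  by apply: mP AP; exact: sub0set.
have [f [g fK gK] Mf] := perfect_matching_coordinates (prime_gt0 p_pr) Mpm.
(* Writing [p] as [q.+2] gives ['I_p] the ring structure of Z/p. *)
case: p p_pr P gP ntP mP nevP M Mpm P0 f g fK gK Mf => [|[|q]] //.
set p := q.+2 => p_pr P gP ntP mP nevP M Mpm P0 f g fK gK Mf.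
pose W := ('I_p * bool)%type.
have ph_inj (h : W -> W) : injective h -> injective (fun v => f (h (g v))).
  by move=> h_inj u v /(can_inj fK)/h_inj/(can_inj gK).
pose ph h (h_inj : injective h) : 'S_(2 * p) := perm (ph_inj h h_inj).
have phE h h_inj x : ph h h_inj (f x) = f (h x) by rewrite permE fK.
have permP_f (s t : 'S_(2 * p)) : (forall x, s (f x) = t (f x)) -> s = t.
  by move=> st; apply/permP => v; rewrite -[v]gK.
pose sh (x : W) : W := ((x.1 + 1)%R, x.2).
have sh_inj : injective sh.
  apply: (can_inj (g := fun x : W => ((x.1 - 1)%R, x.2))) => -[i b].
  by rewrite /sh /= addrK.
pose fl i (x : W) : W := (x.1, x.2 (+) (x.1 == i)).
have fl_inj i : injective (fl i).
  by apply: (can_inj (g := fl i)) => -[j b]; rewrite /fl /= -addbA addbb addbF.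
pose c := ph sh sh_inj; pose tau i := ph (fl i) (fl_inj i).
have cXE k x : (c ^+ k) (f x) = f ((x.1 + 1 *+ k)%R, x.2).
  elim: k => [|k IHk]; first by rewrite expg0 perm1 mulr0n addr0; case: x.
  by rewrite expgSr permM IHk phE /sh /= mulrSr addrA.
have [|t|t u|t||G] := exists_fixed_graph (p := p) (P := P)
    (l := [seq tau i | i : 'I_p]) (c := c) _ gP mP nevP P0.
- exact: p_pr.
- move=> /imageP[i _ ->]; apply: permP_f => x.
  by rewrite permM !phE perm1 /fl /= -addbA addbb addbF; case: x.
- move=> /imageP[i _ ->] /imageP[j _ ->]; apply: permP_f => x.
  by rewrite !permM !phE /fl /= addbAC.
(* Swapping the ends of edge [i] after the shift amounts to swapping those of edge [i - 1] before
   it. *)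
- move=> /imageP[i _ ->]; exists (tau (i - 1)%R); first exact: image_f.
  by apply: permP_f => x; rewrite !permM !phE /fl /sh /= eq_sym -subr_eq eq_sym.
- apply: permP_f => x; rewrite cXE perm1 mulrn_Zp_card addr0.
  by case: x.
case=> GP /set0Pn[e eG] cG tauG.
pose adj (x y : W) := exists2 e, e \in G & val e = [set f x; f y].
have adjC x y : adj x y -> adj y x.
  by case=> e' e'G e'E; exists e'; rewrite // setUC.
have adj_ph h h_inj x y : perm_edge (ph h h_inj) @: G = G ->
    adj x y -> adj (h x) (h y).
  move=> hG [e' e'G e'E]; exists (perm_edge (ph h h_inj) e').
    by rewrite -hG imset_f.
  by rewrite val_perm_edge e'E imsetU1 imset_set1 !phE.
have adj_tau i x y : adj x y -> adj (fl i x) (fl i y).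
  by apply: adj_ph; apply: tauG; exact: image_f.
(* If the chosen edge of [G] has both ends in one pair, their bits differ; otherwise the swaps
   adjust the two bits independently. *)
have [i [j ij]] : exists i j, adj (i, false) (j, true).
  have /cards2P[u [v [uv eE]]] := valP e.
  have : adj (g u) (g v) by exists e; rewrite // !gK.
  have : g u != g v by rewrite (can_eq gK).
  case: (g u) (g v) => i b [j b'] ijb.
  have [ij|ij] := eqVneq i j.
    move: ijb; rewrite -ij xpair_eqE eqxx /=.
    by case: b b' => [] [] // _ a; exists i, i; [exact: adjC | exact: a].
  have flipi d d' : adj (i, d) (j, d') -> adj (i, ~~ d) (j, d').
    by move=> /(adj_tau i); rewrite /fl /= eqxx addbT eq_sym (negPf ij) addbF.
  have flipj d d' : adj (i, d) (j, d') -> adj (i, d) (j, ~~ d').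
    by move=> /(adj_tau j); rewrite /fl /= eqxx addbT (negPf ij) addbF.
  move=> a; exists i, j.
  case: b b' {ijb} a => [] [] // a.
  - exact: (flipi _ _ a).
  - exact: (flipj _ _ (flipi _ _ a)).
  - exact: (flipj _ _ a).
have shift_adj k : adj ((i + 1 *+ k)%R, false) ((j + 1 *+ k)%R, true).
  elim: k => [|k IHk]; first by rewrite mulr0n !addr0.
  by have := adj_ph sh sh_inj _ _ cG IHk; rewrite /sh /= !mulrSr !addrA.
(* Shifting the edge found above by [x - i] moves its ends to [(x, false)] and [(x + d, true)]. *)
pose d : 'I_p := (j - i)%R.
have diag_adj x : adj (x, false) ((x + d)%R, true).
  have := shift_adj (x - i)%R; have -> : (1 *+ (x - i)%R = x - i :> 'I_p)%R.
    exact: natr_Zp.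
  by rewrite /d addrC subrK addrA [(j + x)%R]addrC addrA.
(* Moving only the ends with bit [true], by [d], carries [M] onto the perfect matching just found in
   [G]. *)
pose sk (x : W) : W := ((if x.2 then x.1 + d else x.1)%R, x.2).
have sk_inj : injective sk.
  apply: (can_inj (g := fun x : W => ((if x.2 then x.1 - d else x.1)%R, x.2))).
  by case=> k [] //=; rewrite /sk /= addrK.
pose r := ph sk sk_inj.
have rMG : perm_edge r @: M \subset G.
  apply/subsetP => _ /imsetP[e1 e1M ->]; have [k e1E] := Mf e1 e1M.
  have [e2 e2G e2E] := diag_adj k.
  suff -> : perm_edge r e1 = e2 by [].
  by apply/val_inj; rewrite val_perm_edge e1E e2E imsetU1 imset_set1 !phE.
have := graph_property_perm r^-1 gP (mP _ _ rMG GP).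
rewrite -perm_graphM mulgV; congr (_ \in P).
by rewrite -[RHS]imset_id; apply: eq_imset => e1; exact: perm_edge1.
Qed.
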